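(* Let $d\in\mathbb{N}$, $d\geq 1$, and let $f(1),f(2),\ldots,f(d)$ be positive real numbers such that $f(1)+f(2)+\cdots+f(d)=1$. Then there exists an infinite sequence $\mathbf{v}$ over the alphabet $\{1,2,\ldots,d\}$ such that 1. the frequency of the letter $i$ in $\mathbf{v}$ is $f(i)$ for each $i\in\{1,2,\ldots,d\}$; 2. $\mathbf{v}$ is $k$-balanced with $k=\lceil\log_2 d\rceil$; 3. the factor complexity of $\mathbf{v}$ satisfies $\mathcal{C}_{\mathbf{v}}(n)\leq (n+1)^{d-1}$ for all $n\in\mathbb{N}$.
   Context: A sequence $\mathbf{v}=v_0v_1v_2\cdots$ over a finite alphabet $\mathcal{A}$ is an infinite sequence (indexed by $\mathbb{N}=\{0,1,2,\ldots\}$) of letters of $\mathcal{A}$. The frequency of a letter $a$ in $\mathbf{v}$ is the limit (if it exists) $\lim_{n\to\infty}\frac{\#\{i<n:\ v_i=a\}}{n}$. A word $w$ is a factor of $\mathbf{v}$ if $w=v_iv_{i+1}\cdots v_{i+|w|-1}$ for some $i\in\mathbb{N}$, where $|w|$ is the length of $w$; $|w|_a$ denotes the number of occurrences of the letter $a$ in $w$. For $k\in\mathbb{N}$, $\mathbf{v}$ is $k$-balanced if for any two factors $x,y$ of $\mathbf{v}$ of the same length and any letter $a\in\mathcal{A}$ one has $\bigl||x|_a-|y|_a\bigr|\leq k$. The factor complexity of $\mathbf{v}$ is the map $\mathcal{C}_{\mathbf{v}}:\mathbb{N}\to\mathbb{N}$, where $\mathcal{C}_{\mathbf{v}}(n)$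 is the number of distinct factors of $\mathbf{v}$ of length $n$. *)

(* Defs.v *)
From mathcomp Require Import all_boot all_order all_algebra.
From mathcomp Require Import all_classical all_reals all_analysis.
Import Order.TTheory GRing.Theory Num.Theory.
Import numFieldNormedType.Exports.

Set Implicit Arguments.
Unset Strict Implicit.
Unset Printing Implicit Defensive.

Local Open Scope ring_scope.
Local Open Scope classical_set_scope.

Definition has_frequency (R : realType) (A : finType) (v : nat -> A) (a : A)
    (r : R) : Prop :=
  (fun n : nat => #|[pred i : 'I_n | v i == a]|%:R / n%:R : R) @ \oo --> r.

Definition factor (A : finType) (v : nat -> A) (w : seq A) : Prop :=
  exists i : nat, w = [seq v j | j <- iota i (size w)].

Definition balanced (A : finType) (k : nat) (v : nat -> A) : Prop :=
  forall (x y : seq A) (a : A), factor v x -> factor v y -> size x = size y ->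
    `|(count_mem a x)%:Z - (count_mem a y)%:Z| <= k%:Z.

Definition factor_complexity (A : finType) (v : nat -> A) (n : nat) : nat :=
  #|[pred w : n.-tuple A | `[< factor v w >]]|.

Definition log2 (R : realType) (x : R) : R := ln x / ln 2.

(* Main.v *)
Require Import Defs.
From mathcomp Require Import all_boot all_order all_algebra.
From mathcomp Require Import all_classical all_reals all_analysis.
From mathcomp Require Import zify ring lra.
Import Order.TTheory GRing.Theory Num.Theory.
Import numFieldNormedType.Exports.

Set Implicit Arguments.
Unset Strict Implicit.
Unset Printing Implicit Defensive.

(** The sequence is obtained by colouring.  Given a binary sequence [u] and two
    sequences over disjoint alphabets, write the first sequence on the places
    where [u] is [true] and the second one on the places where [u] is [false].
    Splitting the [d] letters into two halves, colouring a suitable binary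
    sequence by two sequences built recursively on the halves, and stopping at
    single letters, gives a binary tree of depth [ceil (log2 d)].

    At each node [u] is the mechanical word whose prefix of length [n] contains
    [floor (n * alpha)] times [true], where [alpha] is the relative weight of
    the first half.  Such a word is 1-balanced, has at most [n + 1] factors of
    length [n], and has bounded discrepancy [occ - n * alpha].  The three
    properties of the coloured sequence then follow level by level.
    - Discrepancy stays bounded and densities multiply, since a letter is
      counted in the coloured sequence by composing two counting functions
      ([occ_colour]).  Bounded discrepancy implies the frequency statement.
    - Each level costs 1 in balance ([occ_balanced_colour]): two windows of the
      same length of the coloured sequence use windows of a component whose
      lengths differ by at most 1.
    - A window of the coloured sequence is determined by the window of [u] and
      by one window of each component, none of them longer than it
      ([colour_window]).  So the bounds multiply:
      [(n+1) * (n+1)^(d1-1) * (n+1)^(d2-1) = (n+1)^(d1+d2-1)]. *)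

Local Open Scope ring_scope.

(** * Counting letters in prefixes *)

Definition occ (A : finType) (v : nat -> A) (a : A) (n : nat) : nat :=
  (\sum_(i < n) (v i == a))%N.

(** Balance through prefix counts: the count in the window of length [n] at
    [i] is [occ v a (i + n) - occ v a i], and moving the subtracted terms to
    the other sides avoids truncated subtraction. *)
Definition occ_balanced (A : finType) (k : nat) (v : nat -> A) : Prop :=
  forall (a : A) (i j n : nat),
    (occ v a (i + n) + occ v a j <= occ v a (j + n) + occ v a i + k)%N.

(** Bounded discrepancy is a quantitative form of having frequency [r]; it
    passes to coloured sequences by a triangle inequality, with no limits to
    compose. *)
Definition bounded_discrepancy (R : realType) (A : finType) (v : nat -> A)
    (a : A) (r : R) : Prop :=
  exists C : R, forall n : nat, `|(occ v a n)%:R - n%:R * r| <= C.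

(** An upper bound on the number of windows of length [n], given by an explicit
    labelling of positions that determines the window.  Labels combine by
    pairing, which makes the count of a coloured sequence a product. *)
Definition windows_coded (A : finType) (v : nat -> A) (n c : nat) : Prop :=
  exists (T : finType) (g : nat -> T),
    #|T| = c /\
    forall i j : nat, g i = g j ->
      forall l : nat, (l < n)%N -> v (i + l)%N = v (j + l)%N.

Lemma occ0 (A : finType) (v : nat -> A) a : occ v a 0 = 0%N.
Proof. by rewrite /occ big_ord0. Qed.

Lemma occS (A : finType) (v : nat -> A) a n :
  occ v a n.+1 = (occ v a n + (v n == a))%N.
Proof. by rewrite /occ big_ord_recr. Qed.

Lemma leq_occ (A : finType) (v : nat -> A) a m n :
  (m <= n)%N -> (occ v a m <= occ v a n)%N.
Proof.
move=> /subnKC <-; elim: (n - m)%N => [|p IHp]; first by rewrite addn0.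
by rewrite addnS occS (leq_trans IHp) ?leq_addr.
Qed.

Lemma occ_absent (A : finType) (v : nat -> A) a :
  (forall i, v i != a) -> forall n, occ v a n = 0%N.
Proof. by move=> va n; rewrite /occ big1 // => i _; rewrite (negPf (va i)). Qed.

Lemma occ_constant (A : finType) (a b : A) n :
  occ (fun=> a) b n = (n * (a == b))%N.
Proof. by rewrite /occ sum_nat_const card_ord. Qed.

Lemma occ_true_false (u : nat -> bool) n : (occ u true n + occ u false n = n)%N.
Proof. by elim: n => [|n IHn]; rewrite ?occ0 // !occS; case: (u n) => /=; lia. Qed.

Lemma count_window (A : finType) (v : nat -> A) a i n :
  (occ v a i + count_mem a [seq v j | j <- iota i n] = occ v a (i + n))%N.
Proof.
elim: n i => [|n IHn] i /=; first by rewrite !addn0.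
by rewrite addnA -occS IHn addnS.
Qed.

Lemma occ_balanced_constant (A : finType) (a : A) k :
  occ_balanced k (fun=> a).
Proof. by move=> b i j n; rewrite !occ_constant; case: (a == b); lia. Qed.

Lemma bounded_discrepancy_constant (R : realType) (A : finType) (a : A) :
  bounded_discrepancy (R := R) (fun=> a) a 1.
Proof.
by exists 0 => n; rewrite occ_constant eqxx muln1 mulr1 subrr normr0.
Qed.

Lemma windows_coded_constant (A : finType) (a : A) n :
  windows_coded (fun=> a) n 1.
Proof. by exists unit, (fun=> tt); rewrite card_unit. Qed.

(** * Colouring *)

Definition colour (A B : finType) (u : nat -> B) (v : B -> nat -> A)
    (n : nat) : A :=
  v (u n) (occ u (u n) n).

Lemma occ_colour_sum (A B : finType) (u : nat -> B) (v : B -> nat -> A) a n :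
  occ (colour u v) a n = (\sum_b occ (v b) a (occ u b n))%N.
Proof.
elim: n => [|n IHn].
  by rewrite occ0 big1 // => b _; rewrite !occ0.
rewrite occS IHn /colour (bigD1 (u n)) //= [in RHS](bigD1 (u n)) //=.
rewrite [occ u (u n) n.+1]occS eqxx addn1 occS.
under [in RHS]eq_bigr => b /negPf ub do rewrite occS eq_sym ub addn0.
by rewrite addnAC.
Qed.

(** When only the component [v b] uses the letter [a], counting [a] in the
    coloured sequence is the composition of two counting functions. *)
Lemma occ_colour (A B : finType) (u : nat -> B) (v : B -> nat -> A) a b n :
  (forall c, c != b -> forall i, v c i != a) ->
  occ (colour u v) a n = occ (v b) a (occ u b n).
Proof.
move=> va; rewrite occ_colour_sum (bigD1 b) //= big1 ?addn0 // => c cb.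
exact/occ_absent/va.
Qed.

(** Equally long windows of the coloured sequence contain windows of [v b]
    whose lengths differ by at most 1: the common length costs [k], the
    possible extra letter costs 1. *)
Lemma occ_balanced_colour (A B : finType) (u : nat -> B) (v : B -> nat -> A) k :
  (forall a, exists b, forall c, c != b -> forall i, v c i != a) ->
  occ_balanced 1 u -> (forall b, occ_balanced k (v b)) ->
  occ_balanced k.+1 (colour u v).
Proof.
move=> disj ubal vbal a i j n; have [b va] := disj a.
rewrite !(occ_colour u _ va).
have := ubal b i j n.
have := leq_occ u b (leq_addr n i); have := leq_occ u b (leq_addr n j).
move: (occ u b (i + n)) (occ u b (j + n)) (occ u b i) (occ u b j).
move=> x' y' x y yy' xx' hxy.
have := vbal b a x y (y' - y)%N; rewrite (subnKC yy').
have [le_x' | lt_x'] := leqP x' (x + (y' - y)).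
  by have := leq_occ (v b) a le_x'; lia.
have -> : x' = (x + (y' - y)).+1 by lia.
by rewrite occS; case: (_ == a) => /=; lia.
Qed.

(** The offsets inside the components are the counts within the window of
    [u], hence agree as soon as the windows of [u] agree. *)
Lemma colour_window (A B : finType) (u : nat -> B) (v : B -> nat -> A) i j n :
  (forall l, (l < n)%N -> u (i + l)%N = u (j + l)%N) ->
  (forall b l, (l < n)%N -> v b (occ u b i + l)%N = v b (occ u b j + l)%N) ->
  forall l, (l < n)%N -> colour u v (i + l)%N = colour u v (j + l)%N.
Proof.
move=> hu hv l ln.
have same_offset b m : (m <= n)%N -> exists2 t, (t <= m)%N &
    occ u b (i + m) = (occ u b i + t)%N /\ occ u b (j + m) = (occ u b j + t)%N.
  elim: m => [_|m IHm mn]; first by exists 0%N; rewrite // !addn0.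
  have [t tm [ei ej]] := IHm (ltnW mn).
  exists (t + (u (j + m)%N == b))%N; first by case: (_ == b); lia.
  by rewrite !addnS !occS ei ej (hu m mn) !addnA.
rewrite /colour (hu l ln).
have [t tl [-> ->]] := same_offset (u (j + l)%N) l (ltnW ln).
exact/hv/(leq_ltn_trans tl).
Qed.

Lemma windows_coded_colour (A : finType) (u : nat -> bool)
    (v : bool -> nat -> A) n c c1 c2 :
  windows_coded u n c -> windows_coded (v true) n c1 ->
  windows_coded (v false) n c2 ->
  windows_coded (colour u v) n (c * (c1 * c2)).
Proof.
move=> [T [g [cT hg]]] [T1 [g1 [cT1 hg1]]] [T2 [g2 [cT2 hg2]]].
exists (T * (T1 * T2))%type,
  (fun i => (g i, (g1 (occ u true i), g2 (occ u false i)))).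
split; first by rewrite !card_prod cT cT1 cT2.
move=> i j [/hg eu /hg1 e1 /hg2 e2]; apply: colour_window => // -[|] l ln.
- exact: e1.
- exact: e2.
Qed.

Lemma bounded_discrepancy_colour (R : realType) (A B : finType)
    (u : nat -> B) (v : B -> nat -> A) a b (alpha r : R) :
  (forall c, c != b -> forall i, v c i != a) ->
  bounded_discrepancy u b alpha -> bounded_discrepancy (v b) a r ->
  bounded_discrepancy (colour u v) a (alpha * r).
Proof.
move=> va [C hC] [D hD]; exists (D + C * `|r|) => n; rewrite (occ_colour u _ va).
set m := occ u b n.
have -> : (occ (v b) a m)%:R - n%:R * (alpha * r) =
    ((occ (v b) a m)%:R - m%:R * r) + (m%:R - n%:R * alpha) * r by ring.
apply: le_trans (ler_normD _ _) _; rewrite normrM.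
by apply: lerD; [exact: hD | rewrite ler_wpM2r // hC].
Qed.

(** * Mechanical words *)

(** The inequalities characterise [occ u true n] as the floor of [n * alpha];
    this form is what linear arithmetic uses. *)
Definition mechanical (R : realType) (alpha : R) (u : nat -> bool) : Prop :=
  forall n, (occ u true n)%:R <= n%:R * alpha < (occ u true n)%:R + 1.

(** The floor of [n * alpha] increases by 0 or 1 at each step, so it is the
    counting function of a binary sequence. *)
Lemma mechanical_word (R : realType) (alpha : R) :
  0 < alpha < 1 -> exists u : nat -> bool, mechanical alpha u.
Proof.
move=> /andP[a0 a1].
pose N n := Num.truncn (n%:R * alpha).
have hN n : (N n)%:R <= n%:R * alpha < (N n)%:R + 1.
  by rewrite natr1; apply: truncn_itv; rewrite mulr_ge0 // ltW.
exists (fun n => (N n < N n.+1)%N) => n.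
suff -> : occ (fun n => (N n < N n.+1)%N) true n = N n by [].
elim: n => [|n IHn]; first by rewrite occ0 /N mul0r truncn0.
have /andP[l1 r1] := hN n; have /andP[l2 r2] := hN n.+1.
have e : n.+1%:R * alpha = n%:R * alpha + alpha by rewrite -natr1; ring.
have le1 : (N n < (N n.+1).+1)%N by rewrite -(ltr_nat R) -natr1; lra.
have le2 : (N n.+1 < (N n).+2)%N by rewrite -(ltr_nat R) -!natr1; lra.
by rewrite occS IHn eqb_id; lia.
Qed.

(** Adding the floor inequalities at the four positions confines the integer
    [occ (i + n) + occ j - occ (j + n) - occ i] to values below 2.  The count of
    [false] is the complementary one, so it varies by as much. *)
Lemma mechanical_balanced (R : realType) (alpha : R) u :
  mechanical alpha u -> occ_balanced 1 u.
Proof.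
move=> u_mech.
have bal_true i j n : (occ u true (i + n) + occ u true j <=
    occ u true (j + n) + occ u true i + 1)%N.
  have /andP[l1 _] := u_mech (i + n)%N; have /andP[l2 _] := u_mech j.
  have /andP[_ r1] := u_mech (j + n)%N; have /andP[_ r2] := u_mech i.
  rewrite natrD in l1; rewrite natrD in r1.
  by rewrite addn1 -ltnS -(ltr_nat R) -!natr1 !natrD; lra.
move=> [] i j n; first exact: bal_true.
have := bal_true j i n.
have := occ_true_false u i; have := occ_true_false u j.
have := occ_true_false u (i + n)%N; have := occ_true_false u (j + n)%N.
lia.
Qed.

Lemma mechanical_discrepancy (R : realType) (alpha : R) u b :
  mechanical alpha u ->
  bounded_discrepancy u b (if b then alpha else 1 - alpha).
Proof.
move=> u_mech; exists 1 => n; have /andP[l r] := u_mech n.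
case: b; first by rewrite ler_norml; lra.
have := congr1 (fun m => m%:R : R) (occ_true_false u n); rewrite natrD => e.
by rewrite ler_norml; lra.
Qed.

(** The window at [i] is determined by the fractional part of [i * alpha], and
    its prefix counts are nondecreasing functions of that fractional part.
    Hence the prefix counts of two windows are comparable componentwise, so
    that their sum determines them.  Each of the [n] counts takes one of two
    consecutive values, which leaves [n + 1] values for the sum. *)
Lemma mechanical_windows_coded (R : realType) (alpha : R) u n :
  mechanical alpha u -> windows_coded u n n.+1.
Proof.
move=> u_mech.
pose N := occ u true; have N0 : N 0%N = 0%N := occ0 u true.
(* The count in the window of length [l] at [i], minus its least value. *)
pose excess i l := (N (i + l) - N i - N l)%N.
pose g i := (\sum_(l < n) excess i l.+1)%N.
have excessE i l : (N (i + l) = N i + N l + excess i l)%N.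
  have := mechanical_balanced u_mech true 0 i l.
  have /andP[l1 _] := u_mech i; have /andP[l2 _] := u_mech l.
  have /andP[_ r1] := u_mech (i + l)%N; rewrite natrD in r1.
  have : (N i + N l < (N (i + l)).+1)%N.
    by rewrite -(ltr_nat R) -natr1 natrD /N; lra.
  by rewrite /excess -/N; lia.
have excess_le1 i l : (excess i l <= 1)%N.
  have := mechanical_balanced u_mech true i 0 l; by rewrite -/N excessE add0n N0; lia.
have g_lt i : (g i < n.+1)%N.
  rewrite ltnS -[leqRHS](card_ord n) -sum1_card.
  by apply: leq_sum => l _.
exists 'I_n.+1, (fun i => Ordinal (g_lt i)).
split; first by rewrite card_ord.
move=> i j /(congr1 val) /= eq_g.
wlog le_frac : i j eq_g / i%:R * alpha - (N i)%:R <= j%:R * alpha - (N j)%:R.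
  move=> wl; have [|/ltW] := leP (i%:R * alpha - (N i)%:R)
                                 (j%:R * alpha - (N j)%:R).
    exact: wl.
  by move=> h l ln; apply/esym/wl.
have excess_le l : (excess i l <= excess j l)%N.
  have /andP[l1 _] := u_mech (i + l)%N; have /andP[_ r1] := u_mech (j + l)%N.
  rewrite natrD -/N in l1; rewrite natrD -/N in r1.
  suff : (N (i + l) + N j < (N (j + l) + N i).+1)%N
    by have := excessE i l; have := excessE j l; lia.
  by rewrite -(ltr_nat R) -natr1 !natrD; lra.
have excess_eq l : (l <= n)%N -> excess i l = excess j l.
  case: l => [_|l ln]; first by rewrite /excess !addn0 N0 !subnn.
  have [_] := leqif_sum (fun (k : 'I_n) (_ : true) =>
    leqif_eq (excess_le k.+1)).
  by rewrite -/(g i) -/(g j) eq_g eqxx => /esym/forallP/(_ (Ordinal ln))/eqP.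
move=> l ln.
have := excess_eq l (ltnW ln); have := excess_eq l.+1 ln.
have := excessE i l; have := excessE j l.
have := excessE i l.+1; have := excessE j l.+1.
rewrite !addnS /N !occS -/N.
by case: (u (i + l)%N); case: (u (j + l)%N) => //=; lia.
Qed.

(** * Halving the alphabet *)

Lemma subset_of_card (T : finType) (S : {set T}) m :
  (m <= #|S|)%N -> exists2 S1 : {set T}, S1 \subset S & #|S1| = m.
Proof.
move=> mS; exists [set:: take m (enum S)].
  by apply/fintype.subsetP => x; rewrite inE => /mem_take; rewrite mem_enum.
by rewrite cardsE (card_uniqP _) ?take_uniq ?enum_uniq // size_takel // -cardE.
Qed.

(** The weights on [S] need not sum to 1, so that the two halves of an alphabet
    can share one weight function. *)
Definition good_sequence (R : realType) (A : finType) (f : A -> R) (k : nat)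
    (S : {set A}) (v : nat -> A) : Prop :=
  [/\ forall i, v i \in S,
      forall a, a \in S -> bounded_discrepancy v a (f a / \sum_(b in S) f b),
      occ_balanced k v &
      forall n, windows_coded v n (n.+1 ^ #|S|.-1)].

Lemma singleton_sequence (R : realType) (A : finType) (f : A -> R) k
    (S : {set A}) :
  (forall a, 0 < f a) -> #|S| = 1%N -> exists v, good_sequence f k S v.
Proof.
move=> f_gt0 /eqP/cards1P[a ->]; exists (fun=> a); split.
- by move=> i; rewrite inE.
- move=> b; rewrite inE => /eqP->; rewrite big_set1 divff ?gt_eqF //.
  exact: bounded_discrepancy_constant.
- exact: occ_balanced_constant.
- by move=> n; rewrite cards1; exact: windows_coded_constant.
Qed.

(** When [S] has at least two letters, the induction hypothesis applies to
    halves of sizes [#|S|./2] and [uphalf #|S|], both positive.  The density of the first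
    half in [S] is its relative weight, and [occ_balanced_colour] pays for the
    increment of [k].  A singleton stops the recursion whatever [k] is. *)
Lemma coloured_sequence (R : realType) (A : finType) (f : A -> R) k
    (S : {set A}) :
  (forall a, 0 < f a) -> (0 < #|S| <= 2 ^ k)%N ->
  exists v, good_sequence f k S v.
Proof.
move=> f_gt0; elim: k S => [|k IHk] S.
  by rewrite expn0 => S1; apply: singleton_sequence => //; lia.
have [S1 _|S_neq1] := eqVneq #|S| 1%N; first exact: singleton_sequence.
move=> /andP[S_gt0 S_le]; rewrite expnS in S_le.
have [S1 sS1S cS1] : exists2 S1 : {set A}, S1 \subset S & #|S1| = #|S|./2.
  by apply: subset_of_card; lia.
have cD : #|S :\: S1| = uphalf #|S|.
  by rewrite cardsD (finset.setIidPr sS1S) cS1; lia.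
have [|v1 [v1S v1f v1b v1c]] := IHk S1; first by rewrite cS1; lia.
have [|v2 [v2S v2f v2b v2c]] := IHk (S :\: S1); first by rewrite cD; lia.
set W1 := \sum_(b in S1) f b in v1f.
set W2 := \sum_(b in S :\: S1) f b in v2f.
have weight_gt0 (X : {set A}) : (0 < #|X|)%N -> 0 < \sum_(b in X) f b.
  move=> /card_gt0P[x xX]; rewrite (bigD1 x) //= ltr_wpDr //.
  by apply: sumr_ge0 => y _; rewrite ltW.
have W1_gt0 : 0 < W1 by apply: weight_gt0; rewrite cS1; lia.
have W2_gt0 : 0 < W2 by apply: weight_gt0; rewrite cD; lia.
have WE : \sum_(b in S) f b = W1 + W2.
  by rewrite (big_setID S1) /= (finset.setIidPr sS1S).
have [|u u_mech] := @mechanical_word R (W1 / (W1 + W2)).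
  by rewrite divr_gt0 ?addr_gt0 // ltr_pdivrMr ?addr_gt0 // mul1r ltrDl.
pose v b := if b then v1 else v2.
have v_disj a c : c != (a \in S1) -> forall i, v c i != a.
  case: c => /= aS1 i; apply: contraNneq aS1 => <-.
    by rewrite (v1S i).
  by have := v2S i; rewrite inE => /andP[/negPf->].
exists (colour u v); split.
- move=> i; rewrite /colour; case: (u i) => /=.
    exact: (fintype.subsetP sS1S).
  by have := v2S (occ u false i); rewrite inE => /andP[].
- move=> a aS.
  have := mechanical_discrepancy (a \in S1) u_mech.
  move=> /(bounded_discrepancy_colour (v_disj a)) h.
  rewrite WE; case: ifP h => aS1 h.
    have -> : f a / (W1 + W2) = W1 / (W1 + W2) * (f a / W1).
      by field; rewrite !gt_eqF ?addr_gt0.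
    exact/h/v1f.
  have -> : f a / (W1 + W2) = (1 - W1 / (W1 + W2)) * (f a / W2).
    by field; rewrite !gt_eqF ?addr_gt0.
  by apply/h/v2f; rewrite inE aS1.
- apply: occ_balanced_colour; last by case.
    by move=> a; exists (a \in S1); exact: v_disj.
  exact: mechanical_balanced u_mech.
- move=> n.
  have -> : (#|S|.-1 = 1 + (#|S1|.-1 + #|S :\: S1|.-1))%N.
    by rewrite cS1 cD; lia.
  rewrite !expnD expn1; apply: windows_coded_colour => //.
  exact: mechanical_windows_coded n u_mech.
Qed.

(** * Limits, words and logarithms *)

Lemma has_frequency_of_discrepancy (R : realType) (A : finType)
    (v : nat -> A) a (r : R) :
  bounded_discrepancy v a r -> has_frequency v a r.
Proof.
move=> [C hC]; rewrite /has_frequency.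
have -> : (fun n => #|[pred i : 'I_n | v i == a]|%:R / n%:R : R) =
    (fun n => (occ v a n)%:R / n%:R).
  by apply/funext => n; rewrite /occ -sum1_card big_mkcond.
apply/cvgrPdist_le => /= e e_gt0; near=> n.
have n_gt0 : 0 < n%:R :> R by rewrite ltr0n; near: n; exists 1%N.
have -> : r - (occ v a n)%:R / n%:R = - (((occ v a n)%:R - n%:R * r) / n%:R).
  by field; rewrite gt_eqF.
rewrite normrN normrM normfV (gtr0_norm n_gt0) ler_pdivrMr //.
apply: le_trans (hC n) _; rewrite -ler_pdivrMl // mulrC.
by near: n; exact: nbhs_infty_ger.
Unshelve. all: by end_near.
Qed.

Lemma balanced_of_occ (A : finType) k (v : nat -> A) :
  occ_balanced k v -> balanced k v.
Proof.
move=> vbal x y a [i ->] [j ->]; rewrite !size_map !size_iota => <-.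
move: (size x) => n.
have := vbal a i j n; have := vbal a j i n.
by rewrite -!count_window; lia.
Qed.

(** Send a factor to the label of some position where it occurs: equal labels
    give equal windows, so this is injective on factors. *)
Lemma leq_factor_complexity (A : finType) (v : nat -> A) n c :
  windows_coded v n c -> (factor_complexity v n <= c)%N.
Proof.
move=> [T [g [<- hg]]].
pose occurs (w : n.-tuple A) i := w = [seq v j | j <- iota i n] :> seq A.
have [w|pos posP] := choice
    (P := fun (w : n.-tuple A) i => Defs.factor v w -> occurs w i).
  have [[i wi]|nw] := pselect (Defs.factor v w); last by exists 0%N.
  by exists i => _; rewrite /occurs {1}wi size_tuple.
apply: (leq_card_in (g \o pos)) => // w w'.
move=> /asboolP/posP ew /asboolP/posP ew' /hg win.
apply: val_inj; rewrite /= ew ew' -[pos w]addn0 -[pos w']addn0 !iotaDl -!map_comp.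
by apply/eq_in_map => l; rewrite mem_iota /= => /win.
Qed.

Lemma leq_exp_ceil_log2 (R : realType) (d : nat) :
  (1 <= d)%N -> (d <= 2 ^ `|Num.ceil (log2 (d%:R : R))|)%N.
Proof.
move=> d_ge1; set K := `|_|%N.
have ln2_gt0 : 0 < ln 2 :> R by rewrite ln_gt0 // ltr1n.
have d_gt0 : 0 < d%:R :> R by rewrite ltr0n.
have log_ge0 : 0 <= log2 (d%:R : R).
  by apply: divr_ge0; [rewrite ln_ge0 // ler1n | exact: ltW].
have : log2 (d%:R : R) <= K%:R.
  apply: le_trans (ceil_ge _) _.
  by rewrite /K natr_absz ger0_norm // -(ler_int R) (le_trans log_ge0) ?ceil_ge.
rewrite /log2 ler_pdivrMr // mulr_natl -lnXn // ler_ln ?posrE ?exprn_gt0 //.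
by rewrite -natrX ler_nat.
Qed.

Theorem theorem14 (R : realType) (d : nat) (hd : (1 <= d)%N) (f : 'I_d -> R)
    (f_gt0 : forall i : 'I_d, 0 < f i) (f_sum : \sum_(i < d) f i = 1) :
  exists v : nat -> 'I_d,
    [/\ forall i : 'I_d, has_frequency v i (f i),
        balanced `|Num.ceil (log2 (d%:R : R))|%N v &
        forall n : nat, (factor_complexity v n <= (n + 1) ^ (d - 1))%N].
Proof.
have [|v [_ vf vb vc]] := coloured_sequence
    (k := `|Num.ceil (log2 (d%:R : R))|) (S := [set: 'I_d]) f_gt0.
  by rewrite cardsT card_ord hd leq_exp_ceil_log2.
exists v; split.
- move=> i; apply: has_frequency_of_discrepancy.
  have := vf i; rewrite inE => /(_ isT).
  by under eq_bigl do rewrite inE; rewrite f_sum divr1.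
- exact: balanced_of_occ.
- move=> n; rewrite addn1 subn1; apply: leq_factor_complexity.
  by have := vc n; rewrite cardsT card_ord.
Qed.
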